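(* (Pythagoras' theorem) Let $\mathbb{F}$ be a field of characteristic not $2$ and let $B$ be an invertible symmetric $3\times 3$ matrix over $\mathbb{F}$. Let $\overline{v_1v_2v_3}$ be a vector triangle in $\mathbb{V}^3=\mathbb{F}^3$ whose $B$-spreads are defined (i.e. $v_1,v_2,v_3$ are all non-null), with $B$-quadrances $Q_1,Q_2,Q_3$ and corresponding $B$-spreads $s_1,s_2,s_3$. Then $s_3=1$ if and only if $$Q_1+Q_2=Q_3.$$
   Context: $\mathbb{V}^3$ is the space of row vectors over $\mathbb{F}$. The $B$-scalar product is $v\cdot_B w=vBw^T$, the $B$-quadrance is $Q_B(v)=v\cdot_B v$, and $v$ is null if $Q_B(v)=0$. A vector triangle $\overline{v_1v_2v_3}$ is an unordered collection of three vectors with $v_1+v_2+v_3=\mathbf{0}$. Its $B$-quadrances are $Q_i=Q_B(v_i)$. The $B$-spread of non-null vectors $v,w$ is $s_B(v,w)=1-\dfrac{(v\cdot_B w)^2}{Q_B(v)Q_B(w)}$ (undefined if $v$ or $w$ is null), and the $B$-spreads of the triangle are $s_1=s_B(v_2,v_3)$, $s_2=s_B(v_1,v_3)$, $s_3=s_B(v_1,v_2)$. *)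

(* Defs.v *)
From mathcomp Require Import all_boot all_algebra.

Set Implicit Arguments.
Unset Strict Implicit.
Unset Printing Implicit Defensive.

Import GRing.Theory.
Local Open Scope ring_scope.

(* The 1 x 1 matrix v B w^T is identified with its unique entry. *)
Definition Bdot (F : fieldType) (B : 'M[F]_3) (v w : 'rV[F]_3) : F :=
  (v *m B *m w^T) 0 0.

Definition Bquadrance (F : fieldType) (B : 'M[F]_3) (v : 'rV[F]_3) : F :=
  Bdot B v v.

Definition Bnull (F : fieldType) (B : 'M[F]_3) (v : 'rV[F]_3) : Prop :=
  Bquadrance B v = 0.

(* Only meaningful when v and w are both non-null; on null arguments the total
   inverse of the field makes this a junk value. *)
Definition Bspread (F : fieldType) (B : 'M[F]_3) (v w : 'rV[F]_3) : F :=
  1 - Bdot B v w ^+ 2 / (Bquadrance B v * Bquadrance B w).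

(* A labelling v1, v2, v3 of the unordered collection; the predicate is
   invariant under relabelling. *)
Definition vector_triangle (F : fieldType) (v1 v2 v3 : 'rV[F]_3) : Prop :=
  v1 + v2 + v3 = 0.

(* Main.v *)
Require Import Defs.
From mathcomp Require Import all_boot all_algebra.
Import GRing.Theory.
Local Open Scope ring_scope.

(** Two conditions are shown to mean the same thing: [Bdot B v1 v2 = 0].

    The spread of two non-null vectors is [1 - (v1 . v2)^2 / (Q1 Q2)], and in a
    field this equals [1] exactly when [v1 . v2 = 0] ([Bspread_eq1]).  On the
    other hand [v3 = - (v1 + v2)], so polarization of the symmetric form
    ([BquadranceD]) gives [Q3 = Q1 + Q2 + 2 (v1 . v2)]; as [2] is nonzero, the
    equation [Q1 + Q2 = Q3] also says [v1 . v2 = 0]. *)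

Lemma BdotC (F : fieldType) (B : 'M[F]_3) (v w : 'rV[F]_3) :
  B^T = B -> Bdot B v w = Bdot B w v.
Proof.
move=> symB; rewrite /Bdot.
(* A 1 x 1 matrix has the same entry as its transpose. *)
have -> : (v *m B *m w^T) 0 0 = (v *m B *m w^T)^T 0 0 by rewrite [RHS]mxE.
by rewrite !trmx_mul trmxK symB mulmxA.
Qed.

Lemma BdotDl (F : fieldType) (B : 'M[F]_3) (u v w : 'rV[F]_3) :
  Bdot B (u + v) w = Bdot B u w + Bdot B v w.
Proof. by rewrite /Bdot !mulmxDl mxE. Qed.

Lemma BdotDr (F : fieldType) (B : 'M[F]_3) (u v w : 'rV[F]_3) :
  Bdot B u (v + w) = Bdot B u v + Bdot B u w.
Proof. by rewrite /Bdot linearD mulmxDr mxE. Qed.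

Lemma BquadranceN (F : fieldType) (B : 'M[F]_3) (v : 'rV[F]_3) :
  Bquadrance B (- v) = Bquadrance B v.
Proof. by rewrite /Bquadrance /Bdot linearN mulmxN !mulNmx opprK. Qed.

(** Polarization: bilinearity yields the two mixed terms [v . w] and [w . v],
    which symmetry of [B] merges. *)
Lemma BquadranceD (F : fieldType) (B : 'M[F]_3) (v w : 'rV[F]_3) :
  B^T = B ->
  Bquadrance B (v + w) = Bquadrance B v + Bquadrance B w + Bdot B v w *+ 2.
Proof.
move=> symB; rewrite /Bquadrance BdotDl !BdotDr (BdotC _ _ w v symB) mulr2n.
by rewrite [Bdot B v w + Bdot B w w]addrC addrACA.
Qed.

Lemma Bspread_eq1 (F : fieldType) (B : 'M[F]_3) (v w : 'rV[F]_3) :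
  ~ Bnull B v -> ~ Bnull B w -> (Bspread B v w == 1) = (Bdot B v w == 0).
Proof.
move=> /eqP/negPf nnv /eqP/negPf nnw.
rewrite /Bspread -subr_eq0 addrAC subrr sub0r oppr_eq0.
by rewrite mulf_eq0 expf_eq0 invr_eq0 mulf_eq0 nnv nnw !orbF.
Qed.

Theorem theorem20 (F : fieldType) (charF : 2%N \notin [pchar F])
  (B : 'M[F]_3) (symB : B^T = B) (invB : B \in unitmx)
  (v1 v2 v3 : 'rV[F]_3) (tri : vector_triangle v1 v2 v3)
  (nn1 : ~ Bnull B v1) (nn2 : ~ Bnull B v2) (nn3 : ~ Bnull B v3)
  (Q1 Q2 Q3 s1 s2 s3 : F)
  (defQ1 : Q1 = Bquadrance B v1)
  (defQ2 : Q2 = Bquadrance B v2)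
  (defQ3 : Q3 = Bquadrance B v3)
  (defs1 : s1 = Bspread B v2 v3)
  (defs2 : s2 = Bspread B v1 v3)
  (defs3 : s3 = Bspread B v1 v2) :
  s3 = 1 <-> Q1 + Q2 = Q3.
Proof.
have two_neq0 : 2%:R != 0 :> F by move: charF; rewrite inE.
have v3E : v3 = - (v1 + v2) by apply/eqP; rewrite -addr_eq0 addrC; apply/eqP.
have Q3E : (Q1 + Q2 == Q3) = (Bdot B v1 v2 == 0).
  rewrite defQ3 v3E BquadranceN BquadranceD // -defQ1 -defQ2.
  by rewrite eq_sym -subr_eq0 addrAC subrr add0r -mulr_natr mulf_eq0
             (negPf two_neq0) orbF.
rewrite defs3; split=> /eqP.
  by rewrite Bspread_eq1 // -Q3E => /eqP.
by rewrite Q3E -(Bspread_eq1 _ _ _ _ nn1 nn2) => /eqP.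
Qed.
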